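(* Let $n\ge 1$ be an integer and let $q>1$ be an arbitrary real number. Then all positive solutions (with $\lambda>0$) of $$u''+\frac{n-1}{r}u'+\lambda\,(u+u^q)=0 \ \text{ for } 0<r<1,\qquad u'(0)=0,\quad u(1)=0,$$ lie on a unique solution curve in the $(\lambda,u(0))$-plane.
   Context: A positive solution means a pair $(\lambda,u)$ with $\lambda>0$ and $u\in C^2([0,1])$ (regular at $r=0$), $u>0$ on $[0,1)$, satisfying the equation and boundary conditions. Such $u$ are exactly the (radial) positive solutions of $\Delta u+\lambda(u+u^q)=0$ in the unit ball of $\mathbb{R}^n$ with $u=0$ on the boundary. Let $S=\{(\lambda,u(0))\,:\,(\lambda,u)\text{ a positive solution}\}\subset(0,\infty)^2$. The value $u(0)$ uniquely identifies the pair $(\lambda,u)$, so $S$ is the graph of $\lambda$ as a function of $u(0)$. A solution curve is a maximal connected subset of $S$ (a continuous curve in the $(\lambda,u(0))$-plane). The claim says that $S$ consists of a single solution curve. *)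

(* Defs.v *)
From HB Require Import structures.
From mathcomp Require Import all_boot all_order all_algebra.
From mathcomp Require Import all_classical all_reals all_analysis.
Set Implicit Arguments.
Unset Strict Implicit.
Unset Printing Implicit Defensive.
Import Order.TTheory GRing.Theory Num.Theory.
Import numFieldNormedType.Exports.
Local Open Scope classical_set_scope.
Local Open Scope ring_scope.

(* [l] is the derivative at [x] of the restriction of [f] to [D]: at an end   *)
(* point of an interval it is the one-sided derivative, and values of [f]     *)
(* outside [D] play no role.                                                  *)
Definition has_deriv_within (R : realType) (D : set R) (f : R -> R) (x l : R)
    : Prop :=
  (f y - f x) / (y - x) @[y --> within D x^'] --> l.

(* [f] is C^2 on [D], with first and second derivatives [f1] and [f2].        *)
Definition C2_within (R : realType) (D : set R) (f f1 f2 : R -> R) : Prop :=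
  [/\ forall x : R, D x -> has_deriv_within D f x (f1 x),
      forall x : R, D x -> has_deriv_within D f1 x (f2 x) &
      {within D, continuous f2}].

(* Functions on [0, 1] are represented by total functions of which only the   *)
(* values on [0, 1] are constrained or used. Regularity at r = 0 is part of   *)
(* [u] being C^2 up to the end points.                                        *)
Definition positive_solution (R : realType) (n : nat) (q lambda : R)
    (u : R -> R) : Prop :=
  0 < lambda /\
  exists u1 u2 : R -> R,
    [/\ C2_within `[0, 1] u u1 u2,
        forall r : R, 0 <= r < 1 -> 0 < u r,
        forall r : R, 0 < r < 1 ->
          u2 r + (n%:R - 1) / r * u1 r + lambda * (u r + u r `^ q) = 0,
        u1 0 = 0 &
        u 1 = 0].

Definition solution_set (R : realType) (n : nat) (q : R) : set (R * R) :=
  [set p | exists2 u, positive_solution n q p.1 u & p.2 = u 0].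

Definition continuous_curve (R : realType) (C : set (R * R)) : Prop :=
  exists (I : set R) (g : R -> R * R),
    [/\ is_interval I, {within I, continuous g} & C = g @` I].

(* The empty set is [connected] in the library, so it is excluded explicitly. *)
Definition solution_curve (R : realType) (n : nat) (q : R) (C : set (R * R))
    : Prop :=
  [/\ C !=set0,
      C `<=` solution_set n q,
      connected C,
      forall D : set (R * R), D `<=` solution_set n q -> connected D ->
        C `<=` D -> D = C &
      continuous_curve C].

(* Main.v *)
(* Rescaling [r] to [sqrt lambda * r] turns a positive solution into the         *)
(* solution [w] of [w'' + (n - 1) / r w' + w + w^q = 0], [w 0 = a = u 0],        *)
(* [w' 0 = 0], with [sqrt lambda] its first zero. This initial value problem is  *)
(* well posed by a contraction in a weighted norm, [w] is strictly decreasing,   *)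
(* and it always vanishes somewhere because the source dominates its linear      *)
(* part. Hence the solution set is the graph of the squared first zero over all  *)
(* [a > 0]; strict monotonicity and continuous dependence on [a] make the zero   *)
(* continuous, so the graph is a single curve.                                   *)
Require Import Defs.
From HB Require Import structures.
From mathcomp Require Import all_boot all_order all_algebra.
From mathcomp Require Import all_classical all_reals all_analysis.
From mathcomp Require Import ring lra.
Set Implicit Arguments.
Unset Strict Implicit.
Unset Printing Implicit Defensive.
Import Order.TTheory GRing.Theory Num.Theory.
Import numFieldNormedType.Exports.
Local Open Scope classical_set_scope.
Local Open Scope ring_scope.

(** With [n = m + 1], the equation has the flux form [(r^m w')' = - r^m F(w)]: a nonnegative source
    makes the flux [r^m w'] nonincreasing, and two integrations recover [w]. Integrated inequalities
    are obtained throughout by comparing derivatives ([ler_of_derive]).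

    For a fixed height [a], existence ([radial_picard]) and stability ([radial_stability]) both rest
    on [radial_estimate]: against the weight [e^(K r)], the two integrations gain a factor
    [1 / K^2]. The power is not globally Lipschitz, so the source is truncated at some [A >= a]. The
    solution stays in [[0, a]] up to its zero and does not see the cut; beyond the zero the
    truncated source is still nonnegative, so the solution keeps decreasing. Hence its zero is
    unique ([radial_decreasing]), and it exists by a Riccati-type argument ([radial_zero]).

    By [trunc_solution_positive] and [positive_solution_trunc], positive solutions of height [a]
    correspond to the zero [rho], with [lambda = rho^2]; so [lambda] is a function of [a] on the
    whole half-line. Stability preserves the signs of [w] just before and just after [rho], which
    traps the zero of any nearby solution ([solution_parameter_continuous]). The solution set is
    thus the graph of a continuous function over an interval, hence connected, hence its own only
    maximal connected subset. *)

(** * Derivatives, antiderivatives and comparison of functions *)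

Lemma is_derive_slopeP (R : realType) (f : R -> R) (x l : R) :
  is_derive x 1 f l <-> (f y - f x) / (y - x) @[y --> x^'] --> l.
Proof.
have E : ((f y - f x) / (y - x) @[y --> x^'] --> l) <->
    (h^-1 *: (f (h *: 1 + x) - f x) @[h --> 0^'] --> l).
  split=> /cvgrPdist_lt H; apply/cvgrPdist_lt => e /H;
    rewrite !near_withinE => /nbhs_ballP[d d0 /= Hd]; apply/nbhs_ballP;
    exists d => //= y; rewrite -ball_normE /= => yd y0.
    have := Hd (y + x); rewrite -ball_normE /= opprD addrCA subrr addr0 normrN.
    rewrite sub0r normrN in yd; move=> /(_ yd) /=.
    rewrite -[X in _ != X]add0r (inj_eq (addIr x)) => /(_ y0).
    by rewrite addrK [y *: 1]mulr1 [_ *: (_ - _)]mulrC.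
  have := Hd (y - x); rewrite -ball_normE /= sub0r opprB => /(_ yd) /=.
  rewrite subr_eq0 => /(_ y0).
  by rewrite [(y - x) *: 1]mulr1 subrK [_ *: (_ - _)]mulrC.
rewrite E; split=> [[df <-]//|H].
by apply: DeriveDef; [apply/cvg_ex; exists l|exact: cvg_lim].
Qed.

Lemma is_derive_continuous (R : realType) (f : R -> R) (x l : R) :
  is_derive x 1 f l -> {for x, continuous f}.
Proof. by move=> [df _]; apply/differentiable_continuous/derivable1_diffP. Qed.

(** Integrating from -1 and subtracting the value at 0 makes the derivative at 0 two-sided. *)
Lemma continuous_antiderivative (R : realType) (f : R -> R) : continuous f ->
  exists F : R -> R, F 0 = 0 /\ forall x : R, -1 < x -> is_derive x 1 F (f x).
Proof.
move=> cf; pose mu := @lebesgue_measure R.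
pose F x := (\int[mu]_(t in `[(-1 : R), x]) f t)%R.
exists (fun x => F x - F 0); split=> [|x x1]; first exact: subrr.
have [||dF F1] := @continuous_FTC1_closed R f (-1) x (x + 1) _ _ x1 (cf x).
- by rewrite ltrDl.
- apply: continuous_compact_integrable; first exact: segment_compact.
  exact: continuous_subspaceT.
have dF1 : is_derive x 1 F (f x) by rewrite -F1 derive1E; exact: derivableP.
by rewrite -[f x]subr0; apply: is_deriveB.
Qed.

Lemma ler_of_derive (R : realType) (a b : R) (P p Q q : R -> R) :
  a <= b ->
  {within `[a, b], continuous P} -> {within `[a, b], continuous Q} ->
  (forall x : R, a < x < b -> is_derive x 1 P (p x)) ->
  (forall x : R, a < x < b -> is_derive x 1 Q (q x)) ->
  (forall x : R, a < x < b -> p x <= q x) ->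
  P a <= Q a -> P b <= Q b.
Proof.
move=> ab cP cQ dP dQ pq PQ.
have [|ba] := ltP a b; last first.
  by have -> : b = a by apply/le_anti; rewrite ab ba.
move=> altb.
have [x xab|x|c] := @MVT R (Q - P) (fun x => q x - p x) a b altb.
- by apply: is_deriveB; [apply: dQ|apply: dP]; rewrite in_itv in xab.
- move=> z; apply: continuousD; first exact: cQ.
  apply: continuousN; exact: cP.
rewrite in_itv /= => cab; rewrite !fctE => H.
have : 0 <= (q c - p c) * (b - a) by rewrite mulr_ge0 ?subr_ge0 ?pq.
by rewrite -H; lra.
Qed.

Lemma ler_norm_of_derive (R : realType) (a b : R) (P p Q q : R -> R) :
  a <= b ->
  {within `[a, b], continuous P} -> {within `[a, b], continuous Q} ->
  (forall x : R, a < x < b -> is_derive x 1 P (p x)) ->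
  (forall x : R, a < x < b -> is_derive x 1 Q (q x)) ->
  (forall x : R, a < x < b -> `|p x| <= q x) ->
  `|P a| <= Q a -> `|P b| <= Q b.
Proof.
move=> ab cP cQ dP dQ pq; rewrite !ler_norml => /andP[PQa1 PQa2].
apply/andP; split; last first.
  apply: (ler_of_derive ab cP cQ dP dQ) => // x /pq.
  by rewrite ler_norml => /andP[].
rewrite lerNl.
apply: (@ler_of_derive R a b (- P) (- p) Q q) => //.
- by move=> x; apply: continuousN; exact: cP.
- by move=> x xab; apply: is_deriveN; exact: dP.
- by move=> x /pq; rewrite ler_norml => /andP[]; rewrite !fctE; lra.
- by rewrite fctE lerNl.
Qed.

Lemma is_derive_continuous_within (R : realType) (a b : R) (f df : R -> R) :
  (forall x : R, a <= x <= b -> is_derive x 1 f (df x)) ->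
  {within `[a, b], continuous f}.
Proof.
move=> H; apply: derivable_within_continuous => x; rewrite in_itv /= => xab.
by case: (H x xab).
Qed.

(** * The radial equation *)

Lemma is_derive_expn (R : realType) (m : nat) (x : R) :
  is_derive x 1 (fun y : R => y ^+ m) (m%:R * x ^+ m.-1).
Proof.
have := @is_deriveX R R id m x 1 1 (is_derive_id _ _).
by rewrite exprfctE [_ *: 1]mulr1.
Qed.

Lemma is_derive_mull (R : realType) (f : R -> R) (c x l : R) :
  is_derive x 1 f l -> is_derive x 1 (fun y => c * f y) (c * l).
Proof. by move=> df; have := is_deriveZ c df. Qed.

Lemma is_derive_addl (R : realType) (f : R -> R) (c x l : R) :
  is_derive x 1 f l -> is_derive x 1 (fun y => c + f y) l.
Proof.
by move=> df; have := is_deriveD (is_derive_cst c x 1) df; rewrite add0r.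
Qed.

Lemma is_derive_scaled (R : realType) (f : R -> R) (c x l : R) :
  is_derive (c * x) 1 f l -> is_derive x 1 (fun y => f (c * y)) (c * l).
Proof.
move=> df; rewrite mulrC.
apply: (@is_derive1_comp R f (fun y => c * y)) => //.
by rewrite -[X in is_derive _ _ _ X]mulr1; apply: is_derive_mull.
Qed.

Lemma is_derive_expRM (R : realType) (c x : R) :
  is_derive x 1 (fun y => expR (c * y)) (c * expR (c * x)).
Proof. exact: is_derive_scaled. Qed.

(* The radial equation in dimension [m + 1]: [d1 = d'] and                       *)
(* [d1' + (m / r) d1 = g], i.e. [(r^m d1)' = r^m g].                             *)
Definition radial_pair (R : realType) (m : nat) (b : R) (d d1 g : R -> R) :=
  [/\ {within `[0, b], continuous d}, {within `[0, b], continuous d1},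
      d1 0 = 0,
      forall r : R, 0 < r < b -> is_derive r 1 d (d1 r) &
      forall r : R, 0 < r < b -> is_derive r 1 d1 (g r - m%:R / r * d1 r)].

Lemma continuous_expn (R : realType) (m : nat) :
  continuous (fun y : R => y ^+ m).
Proof. by move=> x; apply: is_derive_continuous; exact: is_derive_expn. Qed.

Lemma radial_flux_derive (R : realType) m b (d d1 g : R -> R) :
  radial_pair m b d d1 g -> forall r : R, 0 < r < b ->
  is_derive r 1 (fun r => r ^+ m * d1 r) (r ^+ m * g r).
Proof.
move=> [_ _ _ _ dd1] r /[dup] rb /andP[r0 _].
apply: is_derive_eq; first by apply: is_deriveM;
  [exact: is_derive_expn|exact: dd1].
(* The product rule yields [m * r^(m-1)] with a truncated predecessor, so [m = 0] is separate. *)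
rewrite /GRing.scale /=; case: m {dd1} => [|m]; first by rewrite !expr0; ring.
rewrite exprS /=; field; exact: lt0r_neq0.
Qed.

Lemma within_continuousM (R : realType) (A : set R) (f g : R -> R) :
  {within A, continuous f} -> {within A, continuous g} ->
  {within A, continuous (fun x => f x * g x)}.
Proof.
move=> /subspace_continuousP cf /subspace_continuousP cg.
by apply/subspace_continuousP => x Ax; apply: cvgM; [exact: cf|exact: cg].
Qed.

Lemma radial_flux_continuous (R : realType) m b (d d1 g : R -> R) :
  radial_pair m b d d1 g ->
  {within `[0, b], continuous (fun r => r ^+ m * d1 r)}.
Proof.
move=> [_ cd1 _ _ _]; apply: within_continuousM; last exact: cd1.
apply: continuous_subspaceT; exact: continuous_expn.
Qed.

Lemma radial_pairB (R : realType) m b (d d1 g e e1 h : R -> R) :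
  radial_pair m b d d1 g -> radial_pair m b e e1 h ->
  radial_pair m b (d - e) (d1 - e1) (g - h).
Proof.
move=> [cd cd1 d10 dd dd1] [ce ce1 e10 de de1]; split.
- by move=> x; apply: continuousD; [exact: cd|apply: continuousN; exact: ce].
- by move=> x; apply: continuousD; [exact: cd1|apply: continuousN; exact: ce1].
- by rewrite !fctE d10 e10 subrr.
- by move=> r rb; apply: is_deriveB; [exact: dd|exact: de].
- move=> r rb; apply: is_derive_eq.
    by apply: is_deriveB; [exact: dd1|exact: de1].
  by rewrite !fctE; ring.
Qed.

Lemma radial_pair_sub (R : realType) m b b' (d d1 g : R -> R) :
  b' <= b -> radial_pair m b d d1 g -> radial_pair m b' d d1 g.
Proof.
move=> bb [cd cd1 d10 dd dd1].
have S : `[0, b'] `<=` `[0, b] by apply: subset_itvl; rewrite bnd_simp.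
split => //; [exact: continuous_subspaceW cd|exact: continuous_subspaceW cd1| |].
- by move=> r /andP[r0 rb]; apply: dd; rewrite r0 (lt_le_trans rb).
- by move=> r /andP[r0 rb]; apply: dd1; rewrite r0 (lt_le_trans rb).
Qed.

(** Each integration of [e^(K r)] gains [1 / K]. In the first, the flux is compared with
    [r^m * (C / K) e^(K r)], whose derivative is [r^m * C e^(K r)] plus a nonnegative term coming
    from [r^m]; so the constants do not depend on the dimension. *)
Lemma radial_estimate (R : realType) m (b K C : R) (d d1 g : R -> R) :
  0 <= b -> 0 < K -> 0 <= C -> radial_pair m b d d1 g ->
  (forall r, 0 < r < b -> `|g r| <= C * expR (K * r)) ->
  `|d b| <= `|d 0| + C / K ^+ 2 * expR (K * b).
Proof.
move=> b0 K0 C0 rp gC.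
have dExp (c x : R) : is_derive x 1 (fun y => c * expR (K * y))
    (c * (K * expR (K * x))).
  by apply: is_derive_mull; exact: is_derive_expRM.
have cExp (c : R) : continuous (fun y => c * expR (K * y)).
  by move=> x; apply: is_derive_continuous; exact: dExp.
have d1C r : 0 < r < b -> `|d1 r| <= C / K * expR (K * r).
  move=> /andP[r0 rb]; have rp' := radial_pair_sub (ltW rb) rp.
  have H : `|r ^+ m * d1 r| <= r ^+ m * (C / K * expR (K * r)).
    apply: (@ler_norm_of_derive R 0 r (fun x => x ^+ m * d1 x)
      (fun x => x ^+ m * g x) (fun x => x ^+ m * (C / K * expR (K * x)))
      (fun x => x ^+ m * (C * expR (K * x)) +
                C / K * expR (K * x) * (m%:R * x ^+ m.-1))).
    - exact: ltW.
    - exact: radial_flux_continuous rp'.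
    - apply: continuous_subspaceT => x; apply: cvgM; last exact: cExp.
      exact: continuous_expn.
    - exact: radial_flux_derive rp'.
    - move=> x _; apply: is_derive_eq; first by
        apply: is_deriveM; exact: is_derive_expn.
      congr (_ + _); rewrite /GRing.scale /=; field; exact: lt0r_neq0.
    - move=> x /andP[x0 xr]; rewrite normrM ger0_norm ?exprn_ge0 ?(ltW x0)//.
      rewrite -[leLHS]addr0; apply: lerD.
        rewrite ler_wpM2l ?exprn_ge0 ?(ltW x0)// gC// x0; exact: lt_trans rb.
      by rewrite !mulr_ge0 ?expR_ge0 ?exprn_ge0 ?invr_ge0 ?ler0n ?(ltW K0) ?(ltW x0).
    - case: rp' => _ _ -> _ _; rewrite mulr0 normr0.
      by rewrite !mulr_ge0 ?expR_ge0 ?exprn_ge0 ?invr_ge0 // ?(ltW K0).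
  move: H; rewrite normrM ger0_norm ?exprn_ge0 ?(ltW r0)//.
  by rewrite ler_pM2l ?exprn_gt0.
case: (rp) => cd _ _ dd _.
apply: (@ler_norm_of_derive R 0 b d d1
  (fun r => `|d 0| + C / K ^+ 2 * expR (K * r))
  (fun r => C / K * expR (K * r))) => //.
- apply: continuous_subspaceT => x.
  apply: cvgD; [exact: cvg_cst|exact: cExp].
- move=> x _; apply: is_derive_eq.
  by field; exact: lt0r_neq0.
- by rewrite lerDl !mulr_ge0 ?expR_ge0 ?invr_ge0 ?exprn_ge0 // ?(ltW K0).
Qed.

(** Used with [c = sqrt lambda]: the factor [c^2] puts [lambda] in front of the source. *)
Lemma radial_pair_scale (R : realType) m (b c : R) (d d1 g : R -> R) :
  0 < c -> radial_pair m (c * b) d d1 g ->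
  radial_pair m b (fun r => d (c * r)) (fun r => c * d1 (c * r))
    (fun r => c ^+ 2 * g (c * r)).
Proof.
move=> c0 [cd cd1 d10 dd dd1].
have cs (f : R -> R) : {within `[0, c * b], continuous f} ->
    {within `[0, b], continuous (fun r => f (c * r))}.
  move=> /subspace_continuousP cf; apply/subspace_continuousP => x.
  rewrite /= in_itv /= => /andP[x0 xb].
  have cx : [set` `[0, c * b]] (c * x).
    by rewrite /= in_itv /= mulr_ge0 ?(ltW c0)//= ler_pM2l.
  move: (cf _ cx) => /cvgrPdist_lt H; apply/cvgrPdist_lt => e /H.
  rewrite !near_withinE => /nbhs_ballP[dl dl0 /= Hd]; apply/nbhs_ballP.
  exists (dl / c); first by rewrite /= divr_gt0.
  move=> y; rewrite -ball_normE /= => yd; rewrite in_itv /= => /andP[y0 yb].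
  apply: Hd; rewrite -?ball_normE /= ?in_itv /=.
    by rewrite -mulrBr normrM gtr0_norm // mulrC -ltr_pdivlMr.
  by rewrite mulr_ge0 ?(ltW c0)//= ler_pM2l.
have I r : 0 < r < b -> 0 < c * r < c * b.
  by move=> /andP[r0 rb]; rewrite mulr_gt0//= ltr_pM2l.
split.
- exact: cs.
- apply: within_continuousM; last exact: cs.
  apply: continuous_subspaceT; exact: cst_continuous.
- by rewrite mulr0 d10 mulr0.
- by move=> r /I rb; apply: is_derive_scaled; exact: dd.
- move=> r /[dup] /andP[r0 _] /I rb; apply: is_derive_eq.
    exact: (is_derive_mull c (is_derive_scaled (dd1 _ rb))).
  by rewrite /GRing.scale /=; field; rewrite !gt_eqF.
Qed.

Lemma radial_pair_ext (R : realType) m (b : R) (d d1 g h : R -> R) :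
  (forall r, 0 < r < b -> g r = h r) ->
  radial_pair m b d d1 g -> radial_pair m b d d1 h.
Proof. by move=> gh [? ? ? ? H]; split=> // r rb; rewrite -gh//; exact: H. Qed.

(* Derivatives at 0 are two-sided: the values of the functions just left of 0    *)
(* are meaningful, although the equation is only imposed on the right.           *)
Definition radial_sol (R : realType) (m : nat) (w w1 w2 g : R -> R) :=
  [/\ w1 0 = 0,
      forall r : R, 0 <= r -> is_derive r 1 w (w1 r),
      forall r : R, 0 <= r -> is_derive r 1 w1 (w2 r),
      forall r : R, 0 <= r -> {for r, continuous w2} &
      forall r : R, 0 < r -> w2 r + m%:R / r * w1 r = g r].

Lemma radial_sol_pair (R : realType) m (b : R) (w w1 w2 g : R -> R) :
  radial_sol m w w1 w2 g -> radial_pair m b w w1 g.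
Proof.
move=> [w10 dw dw1 cw2 E]; split=> //.
- by apply: is_derive_continuous_within => x /andP[x0 _]; exact: dw.
- by apply: is_derive_continuous_within => x /andP[x0 _]; exact: dw1.
- by move=> r /andP[r0 _]; apply: dw; exact: ltW.
- move=> r /andP[r0 _]; rewrite -E // addrK; apply: dw1; exact: ltW.
Qed.

(* Cauchy's mean value theorem for [G] and [s^(m+1)].                            *)
Lemma mean_quotient (R : realType) m (g G : R -> R) :
  G 0 = 0 -> (forall x : R, -1 < x -> is_derive x 1 G (x ^+ m * g x)) ->
  forall y : R, y != 0 -> `|y| < 1 ->
  exists2 c, `|c| <= `|y| & G y / y ^+ m.+1 = g c / m.+1%:R.
Proof.
move=> G0 dG y y0 y1.
pose h (s : R) := G y * s ^+ m.+1 - y ^+ m.+1 * G s.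
have dh (s : R) : -1 < s ->
    is_derive s 1 h (G y * (m.+1%:R * s ^+ m) - y ^+ m.+1 * (s ^+ m * g s)).
  move=> s1; apply: is_deriveB; apply: is_derive_mull; last exact: dG.
  exact: (is_derive_expn m.+1 s).
have h0 : h 0 = 0 by rewrite /h G0 expr0n /= !mulr0 subrr.
have hy : h y = 0 by rewrite /h mulrC subrr.
move: y1; rewrite ltr_norml => /andP[ym1 y1].
have M (a b : R) : -1 < a -> a < b -> h a = 0 -> h b = 0 -> exists2 c, a < c < b &
    G y * (m.+1%:R * c ^+ m) = y ^+ m.+1 * (c ^+ m * g c).
  move=> a1 ab ha hb.
  have [x||c] := @MVT R h (fun s =>
      G y * (m.+1%:R * s ^+ m) - y ^+ m.+1 * (s ^+ m * g s)) a b ab.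
  - by rewrite in_itv /= => /andP[ax _]; apply: dh; exact: lt_trans ax.
  - apply: is_derive_continuous_within => x /andP[ax _]; apply: dh.
    exact: lt_le_trans ax.
  rewrite in_itv /= ha hb subrr => cab /esym/eqP.
  rewrite mulf_eq0 [b - a == 0]subr_eq0 (gt_eqF ab) orbF subr_eq0 => /eqP.
  by exists c.
have Q (c : R) : c != 0 ->
    G y * (m.+1%:R * c ^+ m) = y ^+ m.+1 * (c ^+ m * g c) ->
    G y / y ^+ m.+1 = g c / m.+1%:R.
  move=> c0 E; apply/eqP; rewrite eqr_div ?expf_neq0 ?pnatr_eq0//.
  have cm : c ^+ m != 0 by rewrite expf_neq0.
  apply/eqP/(mulIf cm); rewrite -mulrA E; ring.
case: (ltgtP y 0) y0 => // [yn|yp] _.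
  have [c /andP[yc c0] E] := M _ _ ym1 yn hy h0.
  exists c; last by apply: Q E; rewrite lt_eqF.
  by rewrite !ltr0_norm// lerN2 ltW.
have [c /andP[c0 cy] E] := M _ _ (ltrN10 R) yp h0 hy.
exists c; last by apply: Q E; rewrite gt_eqF.
by rewrite !gtr0_norm// ltW.
Qed.

(** The solution is explicit: [d1 t] is [t^(-m)] times the integral of [s^m g s] from 0 to [t]. The
    mean value quotient gives [d1 t / t --> g 0 / (m + 1)], which is both the second derivative at 0
    and the limit of [g t - (m / t) d1 t]. *)
Lemma radial_inverse (R : realType) m (g : R -> R) : continuous g ->
  exists d d1 d2 : R -> R, d 0 = 0 /\ radial_sol m d d1 d2 g.
Proof.
move=> cg.
have [G [G0 dG]] := @continuous_antiderivative R (fun s => s ^+ m * g s)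
  (fun x => cvgM (@continuous_expn R m x) (cg x)).
pose d1 (t : R) := G t / t ^+ m.
have d10 : d1 0 = 0 by rewrite /d1 G0 mul0r.
pose d2 (t : R) := if t == 0 then g 0 / m.+1%:R else g t - m%:R / t * d1 t.
have dd1n (t : R) : -1 < t -> t != 0 -> is_derive t 1 d1 (g t - m%:R / t * d1 t).
  move=> t1 t0; have tm : t ^+ m != 0 by rewrite expf_neq0.
  have := is_deriveM (dG t t1) (@is_deriveV _ (fun y => y ^+ m) t _ 1 tm (is_derive_expn m t)).
  move=> H; apply: (is_derive_eq H).
  rewrite /GRing.scale /= /d1; case: (m) tm => [|k] tm /=.
    by rewrite !expr0; field.
  rewrite !exprS in tm *; field.
  by rewrite t0 /= expf_neq0.
have slope : d1 y / y @[y --> 0^'] --> g 0 / m.+1%:R.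
  apply/cvgrPdist_lt => e e0.
  have e1 : 0 < e * m.+1%:R by rewrite mulr_gt0.
  have /cvgrPdist_lt/(_ _ e1) := cg 0.
  move=> /nbhs_ballP[dl /= dl0 Hd].
  rewrite near_withinE; apply/nbhs_ballP; exists (Num.min dl 1).
    by rewrite /= lt_min dl0 ltr01.
  move=> y; rewrite -ball_normE /= sub0r normrN lt_min => /andP[yd y1] y0.
  have [c cy E] := mean_quotient G0 dG y0 y1.
  rewrite /d1 -mulrA -invfM mulrC -exprSr.
  rewrite mulrC E -mulrBl normrM normfV ltr_pdivrMr ?normr_gt0//.
  rewrite [X in _ < _ * X]ger0_norm//; apply: Hd.
  by rewrite -ball_normE /= sub0r normrN (le_lt_trans cy).
have dd1 (t : R) : -1 < t -> is_derive t 1 d1 (d2 t).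
  move=> t1; rewrite /d2; case: eqVneq => [->|t0]; last exact: dd1n.
  apply/is_derive_slopeP; rewrite d10.
  by under eq_fun do rewrite !subr0.
have cd2 (r : R) : 0 <= r -> {for r, continuous d2}.
  rewrite le_eqVlt => /predU1P[<-|r0].
    apply/continuous_withinNx; rewrite {2}/d2 eqxx.
    have H : g y - m%:R * (d1 y / y) @[y --> 0^'] -->
        g 0 - m%:R * (g 0 / m.+1%:R).
      apply: cvgB; last by apply: cvgM; [exact: cvg_cst|exact: slope].
      by move/continuous_withinNx : (cg 0).
    have -> : g 0 / m.+1%:R = g 0 - m%:R * (g 0 / m.+1%:R).
      by rewrite -natr1; field; rewrite natr1 pnatr_eq0.
    apply: cvg_trans H; apply: near_eq_cvg; near=> y.
    rewrite /d2 ifF; last by apply/negbTE; near: y; exact: nbhs_dnbhs_neq.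
    by rewrite mulrA mulrAC.
  have H : g y - m%:R / y * d1 y @[y --> r] --> g r - m%:R / r * d1 r.
    apply: cvgB; first exact: cg.
    apply: cvgM.
      by apply: cvgM; [exact: cvg_cst|apply: cvgV; rewrite ?gt_eqF].
    apply: is_derive_continuous; apply: dd1; lra.
  rewrite /prop_for /continuous_at {2}/d2 gt_eqF//.
  apply: cvg_trans H; apply: near_eq_cvg; near=> y.
  rewrite /d2 gt_eqF//; near: y; exact: lt_nbhsr.
(* [d1] is controlled only on [t > -1]; freezing it left of -1/2 gives a function continuous on the
   whole line, with the same values near [[0, +oo[]. *)
pose e1 (t : R) := d1 (Num.max t (- 2^-1)).
have ce1 : continuous e1.
  move=> t; have cm : {for t, continuous (fun t : R => Num.max t (- 2^-1))}.
    exact: (@continuous_max R R id (fun=> - 2^-1) t cvg_id (cvg_cst _)).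
  apply: (continuous_comp cm).
  apply: is_derive_continuous; apply: dd1.
  by rewrite lt_max; apply/orP; right; lra.
have [d [d0 dd]] := continuous_antiderivative ce1.
exists d, d1, d2; split=> //; split=> //.
- move=> r r0; have := dd r; rewrite /e1 max_l; last by lra.
  by apply; lra.
- by move=> r r0; apply: dd1; lra.
- by move=> r r0; rewrite /d2 gt_eqF// subrK.
Unshelve. all: by end_near. Qed.

(** * The initial value problem *)

(** The intervals of radius [2 M / 2^k] around [u k] are nested, this radius being the tail of the
    geometric series; the supremum of their lower ends lies in all of them. *)
Lemma geometric_limit (R : realType) (u : nat -> R) (M : R) :
  (forall k, `|u k.+1 - u k| <= M / 2 ^+ k) ->
  exists l, forall k, `|l - u k| <= 2 * M / 2 ^+ k.
Proof.
move=> H.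
have M0 : 0 <= M.
  by have := H 0%N; rewrite expr0 divr1; apply: le_trans.
pose lo k := u k - 2 * M / 2 ^+ k; pose hi k := u k + 2 * M / 2 ^+ k.
have E k : 2 * M / 2 ^+ k.+1 = M / 2 ^+ k.
  by rewrite exprS; field; rewrite expf_neq0.
have E2 k : 2 * M / 2 ^+ k = M / 2 ^+ k + M / 2 ^+ k by ring.
have los k : lo k <= lo k.+1.
  by have := H k; rewrite /lo E E2 ler_norml => /andP[]; lra.
have his k : hi k.+1 <= hi k.
  by have := H k; rewrite /hi E E2 ler_norml => /andP[]; lra.
have lohi k : lo k <= hi k.
  have : 0 <= 2 * M / 2 ^+ k by rewrite divr_ge0 ?mulr_ge0 ?exprn_ge0.
  by rewrite /lo /hi; lra.
have mlo := homo_leq (@lexx _ R) (@le_trans _ R) los.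
have mhi := homo_leq (@lexx _ R) (fun y x z (a : y <= x) (b : z <= y) => le_trans b a) his.
have lh j k : lo j <= hi k.
  have [jk|kj] := leqP j k.
    exact: le_trans (mlo _ _ jk) (lohi k).
  exact: le_trans (lohi j) (mhi _ _ (ltnW kj)).
have hs : has_sup (range lo).
  by split; [exists (lo 0%N), 0%N|exists (hi 0%N) => _ [j _ <-]].
exists (sup (range lo)) => k; rewrite ler_norml.
have A : lo k <= sup (range lo) by apply: ub_le_sup; [case: hs|exists k].
have B : sup (range lo) <= hi k.
  by apply: ge_sup; [case: hs|move=> _ [j _ <-]].
by move: A B; rewrite /lo /hi => A B; apply/andP; split; lra.
Qed.

Lemma radial_sol_oppD (R : realType) m (c : R) (w w1 w2 g : R -> R) :
  radial_sol m w w1 w2 g ->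
  radial_sol m (fun r => c - w r) (fun r => - w1 r) (fun r => - w2 r)
    (fun r => - g r).
Proof.
move=> [w10 dw dw1 cw2 E]; split.
- by rewrite w10 oppr0.
- by move=> r r0; apply: is_derive_addl; apply: is_deriveN; exact: dw.
- by move=> r r0; apply: is_deriveN; exact: dw1.
- by move=> r r0; apply: cvgN; exact: cw2.
- by move=> r r0; rewrite -E //; ring.
Qed.

Lemma radial_sol_ext (R : realType) m (w w1 w2 g h : R -> R) :
  (forall r, 0 < r -> g r = h r) ->
  radial_sol m w w1 w2 g -> radial_sol m w w1 w2 h.
Proof. by move=> gh [? ? ? ? H]; split=> // r r0; rewrite -gh// H. Qed.

Definition lipschitz_with (R : realType) (L : R) (F : R -> R) :=
  forall x y, `|F x - F y| <= L * `|x - y|.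

Lemma lipschitz_with_continuous (R : realType) (L : R) (F : R -> R) :
  0 < L -> lipschitz_with L F -> continuous F.
Proof.
move=> L0 FL x; apply/cvgrPdist_lt => e e0; apply/nbhs_ballP.
exists (e / L); first by rewrite /= divr_gt0.
move=> y; rewrite -?ball_normE /= => xy.
by rewrite (le_lt_trans (FL _ _))// mulrC -ltr_pdivlMr.
Qed.

(* Picard iteration; in the weighted norm [sup |w r| e^(-K r)] the integral      *)
(* operator contracts by [L / K^2 <= 1/2].                                       *)
Lemma radial_picard (R : realType) m (L a : R) (F : R -> R) :
  0 < L -> lipschitz_with L F ->
  exists w w1 w2 : R -> R,
    w 0 = a /\ radial_sol m w w1 w2 (fun r => - F (w r)).
Proof.
move=> L0 FL.
have cF := lipschitz_with_continuous L0 FL.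
(* [J] is the solution operator of the linear problem with zero initial data; the zero function is a
   default for discontinuous [g]. *)
have /choice[J HJ] : forall g : R -> R, exists d : R -> R, continuous g ->
    d 0 = 0 /\ exists d1 d2, radial_sol m d d1 d2 g.
  move=> g; have [cg|ncg] := pselect (continuous g); last by exists (fun=> 0).
  have [d [d1 [d2 [d0 ds]]]] := radial_inverse m cg.
  by exists d => _; split => //; exists d1, d2.
pose K := 1 + 2 * L.
have K0 : 0 < K by rewrite /K; lra.
have LK : L / K ^+ 2 <= 2^-1.
  by rewrite ler_pdivrMr ?exprn_gt0// /K expr2; nra.
(* The Picard operator, extended evenly so that iterates are continuous on the whole line and remain
   in the domain of [J]. *)
pose T (v : R -> R) (r : R) := a - J (fun s => F (v s)) `|r|.
have cT (v : R -> R) : continuous v -> continuous (T v).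
  move=> cv.
  have cFv : continuous (fun s => F (v s)).
    by move=> x; apply: continuous_comp; [exact: cv|exact: cF].
  have [_ [d1 [d2 [_ dJ _ _ _]]]] := HJ _ cFv.
  move=> x; apply: cvgB; first exact: cvg_cst.
  apply: (@continuous_comp _ _ _ (fun r : R => `|r|) (J (fun s => F (v s)))).
    exact: norm_continuous.
  by apply: is_derive_continuous; apply: dJ.
have Test (v v' : R -> R) (C r : R) : 0 <= r -> 0 <= C -> continuous v -> continuous v' ->
    (forall s, 0 <= s -> `|v s - v' s| <= C * expR (K * s)) ->
    `|T v r - T v' r| <= C / 2 * expR (K * r).
  move=> r0 C0 cv cv' vv'.
  have cFv : continuous (fun s => F (v s)).
    by move=> x; apply: continuous_comp; [exact: cv|exact: cF].
  have cFv' : continuous (fun s => F (v' s)).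
    by move=> x; apply: continuous_comp; [exact: cv'|exact: cF].
  have [J0 [d1 [d2 dJ]]] := HJ _ cFv.
  have [J0' [d1' [d2' dJ']]] := HJ _ cFv'.
  have := radial_estimate r0 K0 (mulr_ge0 (ltW L0) C0)
    (radial_pairB (radial_sol_pair r dJ') (radial_sol_pair r dJ)).
  rewrite !fctE J0 J0' subrr normr0 add0r => H.
  rewrite /T (ger0_norm r0) opprD addrACA subrr add0r opprK addrC.
  apply: (le_trans (H _)) => [s /andP[s0 _]|].
    rewrite (le_trans (FL _ _))// -mulrA ler_pM2l// distrC.
    exact: vv' (ltW s0).
  rewrite ler_wpM2r ?expR_ge0// mulrAC [C / 2]mulrC ler_wpM2r//.
pose v k := iter k T (fun=> a).
have cv k : continuous (v k).
  by elim: k => [|k IH]; [exact: cst_continuous|exact: cT].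
(* Weighted size of the first Picard step, from the constant [a]. *)
pose C0 := `|F a| / K ^+ 2.
have C00 : 0 <= C0 by rewrite divr_ge0 // exprn_ge0 // ltW.
have vstep k r : 0 <= r -> `|v k.+1 r - v k r| <= C0 * expR (K * r) / 2 ^+ k.
  elim: k r => [|k IH] r r0.
    have ccst : continuous (fun s : R => F ((fun=> a) s)).
      by move=> x; exact: cvg_cst.
    have [J0 [d1 [d2 dJ]]] := HJ _ ccst.
    have := radial_estimate r0 K0 (normr_ge0 (F a)) (radial_sol_pair r dJ).
    rewrite J0 normr0 add0r => H.
    rewrite /v /= /T (ger0_norm r0) addrAC subrr add0r normrN expr0 divr1.
    apply: H => s /andP[s0 _].
    by rewrite ler_peMr// -expR0 ler_expR mulr_ge0// ltW.
  have := Test (v k.+1) (v k) (C0 / 2 ^+ k) r r0 _ (cv _) (cv _).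
  rewrite divr_ge0 ?exprn_ge0// => /(_ isT) H.
  apply: (le_trans (H _)) => [s s0|].
    by rewrite mulrAC; exact: IH.
  by rewrite exprS invfM le_eqVlt; apply/orP; left; apply/eqP; ring.
have vstepn k r : `|v k.+1 r - v k r| <= C0 * expR (K * `|r|) / 2 ^+ k.
  have vn j : v j r = v j `|r|.
    by case: j => // j; rewrite /v /= /T normr_id.
  by rewrite !vn; apply: vstep.
have /choice[z Hz] : forall r, exists l, forall k,
    `|l - v k r| <= 2 * (C0 * expR (K * `|r|)) / 2 ^+ k.
  by move=> r; apply: geometric_limit => k; exact: vstepn.
have small (c e : R) : 0 <= c -> 0 < e -> exists k, c / 2 ^+ k < e.
  move=> c0 e0; exists (Num.bound (c / e)).
  rewrite ltr_pdivrMr ?exprn_gt0// mulrC -ltr_pdivrMr//.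
  apply: (lt_trans (archi_boundP (divr_ge0 c0 (ltW e0)))).
  by rewrite -natrX ltr_nat ltn_expl.
have cz : continuous z.
  move=> x; apply/cvgrPdist_lt => e e0.
  pose c := 2 * (C0 * expR (K * (`|x| + 1))).
  have c0 : 0 <= c by rewrite /c mulr_ge0 // mulr_ge0 // expR_ge0.
  have e3 : 0 < e / 3 by rewrite divr_gt0.
  have [k Hk] := small _ _ c0 e3.
  have zb (y : R) : `|y| <= `|x| + 1 -> `|z y - v k y| < e / 3.
    move=> yx; apply: le_lt_trans Hk; apply: (le_trans (Hz y k)).
    rewrite /c ler_wpM2r ?invr_ge0 ?exprn_ge0// ler_wpM2l// ler_wpM2l//.
    by rewrite ler_expR ler_wpM2l// ltW.
  have /cvgrPdist_lt/(_ _ e3) := cv k x.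
  move=> /nbhs_ballP[dl /= dl0 Hd]; apply/nbhs_ballP.
  exists (Num.min dl 1); first by rewrite /= lt_min dl0 ltr01.
  move=> y; rewrite -?ball_normE /= lt_min => /andP[yd y1].
  have := Hd y; rewrite -?ball_normE => /(_ yd) /= H1.
  have H2 : `|z x - v k x| < e / 3 by apply: zb; rewrite lerDl.
  have H3 : `|z y - v k y| < e / 3.
    apply: zb; rewrite -[y](subrK x) addrC (le_trans (ler_normD _ _))//.
    by rewrite lerD2l distrC ltW.
  move: H1 H2 H3; rewrite !ltr_norml => /andP[? ?] /andP[? ?] /andP[? ?].
  by apply/andP; split; lra.
(* Both [z] and [T z] are within a geometrically small distance of the iterate [v k.+1]. *)
have zT r : 0 <= r -> z r = T z r.
  move=> r0; apply/eqP; rewrite -subr_eq0 -normr_le0; apply/ler_addgt0Pr => e e0.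
  rewrite add0r.
  have c0 : 0 <= 2 * (C0 * expR (K * r)).
    by rewrite mulr_ge0 // mulr_ge0 // expR_ge0.
  have [k Hk] := small _ _ c0 e0.
  have C1 : 0 <= 2 * C0 / 2 ^+ k by rewrite divr_ge0 ?exprn_ge0 // mulr_ge0.
  have H1 := Test z (v k) (2 * C0 / 2 ^+ k) r r0 C1 cz (cv _).
  have {}H1 : `|T z r - v k.+1 r| <= 2 * C0 / 2 ^+ k / 2 * expR (K * r).
    apply: H1 => s s0; apply: (le_trans (Hz s k)); rewrite ger0_norm//.
    by rewrite le_eqVlt; apply/orP; left; apply/eqP; ring.
  have := Hz r k.+1; rewrite (ger0_norm r0) => H2.
  rewrite -(subrK (v k.+1 r) (z r)) -addrA (le_trans (ler_normD _ _))//.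
  rewrite [`|v _ _ - _|]distrC (le_trans (lerD H2 H1))// (le_trans _ (ltW Hk))//.
  rewrite exprS invfM.
  rewrite le_eqVlt; apply/orP; left; apply/eqP; field.
  by rewrite expf_neq0.
have cFz : continuous (fun s => F (z s)).
  by move=> x; apply: continuous_comp; [exact: cz|exact: cF].
have [J0 [d1 [d2 dJ]]] := HJ _ cFz.
exists (fun r => a - J (fun s => F (z s)) r), (fun r => - d1 r), (fun r => - d2 r).
rewrite J0 subr0; split=> //.
apply: radial_sol_ext (radial_sol_oppD a dJ) => r r0.
by rewrite zT ?(ltW r0)// /T gtr0_norm.
Qed.

(** A Gronwall bound by absorption: at the maximum point [c] of the weighted difference,
    [radial_estimate] bounds that maximum by the initial gap plus half of itself. Equal initial
    values give uniqueness; different ones give continuous dependence. *)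
Lemma radial_stability (R : realType) m (b L : R) (F d d1 e e1 : R -> R) :
  0 <= b -> 0 < L -> lipschitz_with L F ->
  radial_pair m b d d1 (fun r => - F (d r)) ->
  radial_pair m b e e1 (fun r => - F (e r)) ->
  forall r, 0 <= r <= b ->
    `|d r - e r| <= 2 * `|d 0 - e 0| * expR ((1 + 2 * L) * r).
Proof.
move=> b0 L0 FL rd re; set K := 1 + 2 * L.
have K0 : 0 < K by rewrite /K; lra.
have LK : L / K ^+ 2 <= 2^-1.
  by rewrite ler_pdivrMr ?exprn_gt0// /K expr2; nra.
have rp := radial_pairB rd re; case: (rp) => cde _ _ _ _.
pose h r := `|d r - e r| * expR (- K * r).
have ch : {within `[0, b], continuous h}.
  apply: within_continuousM.
    by move=> x; apply: cvg_norm; exact: cde.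
  apply: continuous_subspaceT => x.
  exact: (is_derive_continuous (is_derive_expRM (- K) x)).
have [c] := EVT_max b0 ch.
rewrite in_itv /= => /andP[c0 cb] Hc.
have de r : 0 <= r <= b -> `|d r - e r| <= h c * expR (K * r).
  move=> rb; have := Hc r; rewrite in_itv /= => /(_ rb).
  by rewrite {1}/h mulNr expRN ler_pdivrMr ?expR_gt0.
have h0 : 0 <= h c by rewrite /h mulr_ge0 ?expR_ge0.
have := radial_estimate c0 K0 (mulr_ge0 (ltW L0) h0) (radial_pair_sub cb rp).
rewrite !fctE => H.
have {}H : `|d c - e c| <= `|d 0 - e 0| + L * h c / K ^+ 2 * expR (K * c).
  apply: H => r /andP[r0 rc].
  rewrite -opprD normrN (le_trans (FL _ _))// -mulrA ler_pM2l//.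
  by apply: de; rewrite (ltW r0) (le_trans (ltW rc)).
have hD : h c <= `|d 0 - e 0| + 2^-1 * h c.
  rewrite {1}/h mulNr expRN ler_pdivrMr ?expR_gt0// (le_trans H)// [leRHS]mulrDl.
  apply: lerD.
    by rewrite ler_peMr// -expR0 ler_expR mulr_ge0// ltW.
  by rewrite ler_wpM2r ?expR_ge0// mulrAC ler_wpM2r.
move=> r rb; rewrite (le_trans (de _ rb))// ler_wpM2r ?expR_ge0//; lra.
Qed.

(** * The truncated source and the first zero *)

(* Clamping the argument to [0, A] makes [x + x^q] globally Lipschitz and does   *)
(* not affect nonnegative solutions, which stay below their value at 0.          *)
Definition trunc_source (R : realType) (q A x : R) : R :=
  let c := Num.max 0 (Num.min x A) in c + c `^ q.

Lemma clamp_id (R : realType) (A x : R) :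
  0 <= x <= A -> Num.max 0 (Num.min x A) = x.
Proof. by move=> /andP[x0 xA]; rewrite min_l// max_r. Qed.

Lemma clamp_itv (R : realType) (A x : R) :
  0 < A -> 0 <= Num.max 0 (Num.min x A) <= A.
Proof. by move=> A0; rewrite le_max lexx /= ge_max ge_min lexx orbT ltW. Qed.

Lemma clamp_lipschitz (R : realType) (A x y : R) :
  `|Num.max 0 (Num.min x A) - Num.max 0 (Num.min y A)| <= `|x - y|.
Proof.
have := ler_norm (x - y); have := ler_norm (- (x - y)); rewrite normrN => H1 H2.
rewrite ler_norml.
case: (leP x A) => ?; case: (leP y A) => ?;
  case: (leP 0 x) => ?; case: (leP 0 y) => ?; case: (leP 0 A) => ?;
  apply/andP; split; lra.
Qed.

(** Mean value theorem for the power. The case [x = 0] is handled directly by [y^q = y * y^(q-1)],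
    since the derivative rule applies at positive points. *)
Lemma powR_diff_le (R : realType) (q A x y : R) : 1 < q ->
  0 <= x -> x <= y -> y <= A -> y `^ q - x `^ q <= q * A `^ (q - 1) * (y - x).
Proof.
move=> q1 x0 xy yA; have q0 : 0 < q by lra.
have q10 : 0 <= q - 1 by lra.
have mono c : 0 <= c -> c <= A -> c `^ (q - 1) <= A `^ (q - 1).
  move=> c0 cA; apply: ge0_ler_powR => //; rewrite nnegrE //.
  exact: le_trans cA.
have y0 := le_trans x0 xy.
move: x0; rewrite le_eqVlt => /predU1P[x0|x0].
  rewrite -x0 powR0 ?gt_eqF// !subr0 -mulr_powRB1// mulrC ler_wpM2r//.
  rewrite -[leLHS]mul1r ler_pM ?powR_ge0//; first exact: ltW.
  exact: mono.
have [z|z|c] := @MVT_segment R (fun z => z `^ q) (fun z => q * z `^ (q - 1))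
  x y xy.
- rewrite in_itv /= => /andP[xz _]; apply: is_derive1_powR; exact: lt_trans xz.
- apply: is_derive_continuous_within => {}z /andP[xz _].
  by apply: is_derive1_powR; exact: lt_le_trans xz.
rewrite in_itv /= => /andP[xc cy] ->.
rewrite ler_wpM2r ?subr_ge0// ler_pM2l// mono//.
  exact: le_trans (ltW x0) xc.
exact: le_trans cy yA.
Qed.

Lemma trunc_source_lipschitz (R : realType) (q A : R) : 0 < A -> 1 < q ->
  lipschitz_with (1 + q * A `^ (q - 1)) (trunc_source q A).
Proof.
move=> A0 q1 x y.
apply: le_trans (_ : _ <= (1 + q * A `^ (q - 1)) *
   `|Num.max 0 (Num.min x A) - Num.max 0 (Num.min y A)|) _; last first.
  rewrite ler_wpM2l ?clamp_lipschitz// addr_ge0// mulr_ge0 ?powR_ge0//; lra.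
rewrite /trunc_source.
have := clamp_itv x A0; have := clamp_itv y A0.
move: (Num.max _ _) (Num.max _ _) => c d /andP[d0 dA] /andP[c0 cA].
wlog dc : c d c0 cA d0 dA / d <= c.
  move=> H; have [dc|/ltW cd] := leP d c; first exact: H.
  rewrite distrC [X in _ <= _ * X]distrC; exact: H.
have := powR_diff_le q1 d0 dc cA => D.
have M : d `^ q <= c `^ q.
  by apply: ge0_ler_powR => //; rewrite ?nnegrE//; lra.
rewrite !ger0_norm; lra.
Qed.

Lemma trunc_source_ge0 (R : realType) (q A x : R) :
  0 < A -> 0 <= trunc_source q A x.
Proof.
by move=> A0; rewrite addr_ge0 ?powR_ge0//; case/andP: (clamp_itv x A0).
Qed.

Lemma trunc_source_id (R : realType) (q A x : R) :
  0 <= x <= A -> trunc_source q A x = x + x `^ q.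
Proof. by move=> xA; rewrite /trunc_source clamp_id. Qed.

Lemma trunc_source_ge (R : realType) (q A x : R) :
  0 <= x <= A -> x <= trunc_source q A x.
Proof. by move=> xA; rewrite trunc_source_id// lerDl powR_ge0. Qed.

(** * Monotonicity of the flux and of the solution *)

Lemma radial_flux_le (R : realType) m (b s t : R) (d d1 g : R -> R) :
  radial_pair m b d d1 g -> 0 <= s -> s <= t -> t <= b ->
  (forall r, 0 < r < b -> g r <= 0) -> t ^+ m * d1 t <= s ^+ m * d1 s.
Proof.
move=> rp s0 st tb g0.
have sub r : s < r < t -> 0 < r < b.
  by move=> /andP[sr rt]; rewrite (le_lt_trans s0)//= (lt_le_trans rt).
apply: (@ler_of_derive R s t (fun r => r ^+ m * d1 r) (fun r => r ^+ m * g r)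
  (fun=> s ^+ m * d1 s) (fun=> 0)) => //.
- apply: continuous_subspaceW (radial_flux_continuous rp) => r.
  rewrite /= !in_itv /= => /andP[sr rt].
  by rewrite (le_trans s0)//= (le_trans rt).
- apply: continuous_subspaceT => x; exact: cvg_cst.
- by move=> r /sub; exact: radial_flux_derive rp _.
- move=> r /sub /[dup] /andP[r0 _] rb; apply: mulr_ge0_le0; last exact: g0.
  by rewrite exprn_ge0// ltW.
Qed.

(** The flux is compared with [- c r^(m+1) / (m+1)], the flux of the constant source [- c]. *)
Lemma radial_slope_le (R : realType) m (b c : R) (d d1 g : R -> R) :
  radial_pair m b d d1 g -> 0 < b ->
  (forall r, 0 < r < b -> g r <= - c) -> d1 b <= - (c * b / m.+1%:R).
Proof.
move=> rp b0 gc.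
have H : b ^+ m * d1 b <= - (c / m.+1%:R) * b ^+ m.+1.
  apply: (@ler_of_derive R 0 b (fun r => r ^+ m * d1 r) (fun r => r ^+ m * g r)
    (fun r => - (c / m.+1%:R) * r ^+ m.+1)
    (fun r => - (c / m.+1%:R) * (m.+1%:R * r ^+ m))).
  - exact: ltW.
  - exact: radial_flux_continuous rp.
  - apply: continuous_subspaceT => x; apply: cvgM; first exact: cvg_cst.
    exact: continuous_expn.
  - exact: radial_flux_derive rp.
  - move=> r _; apply: is_derive_mull; exact: (is_derive_expn m.+1 r).
  - move=> r /[dup] /andP[r0 _] rb.
    have -> : - (c / m.+1%:R) * (m.+1%:R * r ^+ m) = r ^+ m * - c.
      by field; rewrite addrC natr1 pnatr_eq0.
    by rewrite ler_wpM2l ?exprn_ge0 ?(ltW r0)// gc.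
  - by case: rp => _ _ -> _ _; rewrite mulr0 expr0n mulr0.
have bm : 0 < b ^+ m by rewrite exprn_gt0.
rewrite -(ler_pM2l bm) (le_trans H)// exprS le_eqVlt.
by apply/orP; left; apply/eqP; ring.
Qed.

Lemma radial_antitone (R : realType) m (b : R) (d d1 g : R -> R) :
  radial_pair m b d d1 g -> (forall r, 0 < r < b -> g r <= 0) ->
  forall s t, 0 <= s -> s <= t -> t <= b -> d t <= d s.
Proof.
move=> rp g0 s t s0 st tb; case: (rp) => cd _ _ dd _.
have sub r : s < r < t -> 0 < r < b.
  by move=> /andP[sr rt]; rewrite (le_lt_trans s0)//= (lt_le_trans rt).
apply: (@ler_of_derive R s t d d1 (fun=> d s) (fun=> 0)) => //.
- apply: continuous_subspaceW cd => r.
  rewrite /= !in_itv /= => /andP[sr rt].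
  by rewrite (le_trans s0)//= (le_trans rt).
- apply: continuous_subspaceT => x; exact: cvg_cst.
- by move=> r /sub; exact: dd.
- move=> r /sub /andP[r0 rb].
  have := @radial_slope_le R m r 0 d d1 g (radial_pair_sub (ltW rb) rp) r0.
  rewrite !mul0r oppr0; apply => x /andP[x0 xr].
  by apply: g0; rewrite x0 (lt_trans xr).
Qed.

(** Near 0 the solution is positive, so the source there is bounded away from 0 and the flux becomes
    strictly negative; being nonincreasing, it stays so, even after [w] has changed sign. *)
Lemma radial_slope_lt0 (R : realType) m (a A : R) (F w w1 w2 : R -> R) :
  0 < a <= A -> (forall x, 0 <= F x) -> (forall x, 0 <= x <= A -> x <= F x) ->
  w 0 = a -> radial_sol m w w1 w2 (fun r => - F (w r)) ->
  forall r, 0 < r -> w1 r < 0.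
Proof.
move=> /andP[a0 aA] F0 Fx wa ws r r0.
have ws' b := radial_sol_pair b ws.
have F0' b s : 0 < s < b -> - F (w s) <= 0 by rewrite oppr_le0.
have [s /andP[s0 sr] ws0] : exists2 s, 0 < s < r & 0 < w s.
  case: (ws) => _ dw _ _ _.
  have /cvgrPdist_lt/(_ _ a0) := is_derive_continuous (dw 0 (lexx 0)).
  move=> /nbhs_ballP[dl /= dl0 Hd].
  exists (Num.min dl r / 2).
    rewrite divr_gt0 ?lt_min ?dl0//=.
    have : Num.min dl r <= r by rewrite ge_min lexx orbT.
    by lra.
  have m0 : 0 < Num.min dl r by rewrite lt_min dl0.
  have := Hd (Num.min dl r / 2).
  rewrite -ball_normE /= sub0r normrN gtr0_norm ?divr_gt0//.
  have mdl : Num.min dl r <= dl by rewrite ge_min lexx.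
  have -> : Num.min dl r / 2 < dl by lra.
  by move=> /(_ isT); rewrite wa ltr_norml => /andP[_]; lra.
have w1s : w1 s < 0.
  apply: le_lt_trans (radial_slope_le (ws' s) s0 (c := w s) _) _.
    move=> x /andP[x0 xs]; rewrite lerN2.
    have wxs : w s <= w x.
      by apply: (radial_antitone (ws' s) (F0' s)); rewrite ?(ltW x0) ?(ltW xs).
    apply: (le_trans wxs); apply: Fx; rewrite (le_trans (ltW ws0))//=.
    apply: le_trans aA; rewrite -wa.
    by apply: (radial_antitone (ws' s) (F0' s)); rewrite ?(ltW x0) ?(ltW xs).
  by rewrite oppr_lt0 divr_gt0// mulr_gt0.
have := radial_flux_le (ws' r) (ltW s0) (ltW sr) (lexx r) (F0' r).
move=> H; have {}H : r ^+ m * w1 r < 0.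
  by apply: (le_lt_trans H); rewrite pmulr_rlt0 ?exprn_gt0.
by move: H; rewrite pmulr_rlt0 ?exprn_gt0.
Qed.

Lemma radial_decreasing (R : realType) m (a A : R) (F w w1 w2 : R -> R) :
  0 < a <= A -> (forall x, 0 <= F x) -> (forall x, 0 <= x <= A -> x <= F x) ->
  w 0 = a -> radial_sol m w w1 w2 (fun r => - F (w r)) ->
  forall s t, 0 <= s -> s < t -> w t < w s.
Proof.
move=> aA F0 Fx wa ws s t s0 st.
have neg := radial_slope_lt0 aA F0 Fx wa ws.
case: ws => _ dw _ _ _.
have [x||] := @MVT R w w1 s t st.
- by rewrite in_itv /= => /andP[sx _]; apply: dw; rewrite (le_trans s0)// ltW.
- apply: is_derive_continuous_within => x /andP[sx _]; apply: dw.
  exact: le_trans sx.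
- move=> c; rewrite in_itv /= => /andP[sc ct] H.
  rewrite -subr_lt0 H pmulr_llt0 ?subr_gt0//.
  by apply: neg; exact: le_lt_trans sc.
Qed.

(* While [w > 0], the quotient [- w / w'] is at most [n / r] and, once           *)
(* [r >= 2 n], decreases at rate at least 1/2; so [w] vanishes by [2 n + 1].     *)
Lemma radial_zero (R : realType) m (a A : R) (F w w1 w2 : R -> R) :
  0 < a <= A -> (forall x, 0 <= F x) -> (forall x, 0 <= x <= A -> x <= F x) ->
  w 0 = a -> radial_sol m w w1 w2 (fun r => - F (w r)) ->
  exists2 rho, 0 < rho & w rho = 0.
Proof.
move=> aA F0 Fx wa ws.
have neg := radial_slope_lt0 aA F0 Fx wa ws.
have dec := radial_decreasing aA F0 Fx wa ws.
have ws' b := radial_sol_pair b ws.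
case: (ws) => _ dw dw1 _ E.
pose N : R := m.+1%:R.
have N1 : 1 <= N by rewrite /N ler1n.
have [wN|wN] := leP (w (2 * N + 1)) 0.
  have b0 : 0 <= 2 * N + 1 by lra.
  have cw : {within `[0, 2 * N + 1], continuous w}.
    by apply: is_derive_continuous_within => x /andP[x0 _]; exact: dw.
  have [|c] := IVT b0 cw (v := 0).
    rewrite wa; case/andP: aA => a0 _.
    by rewrite ge_min wN orbT le_max (ltW a0).
  rewrite in_itv /= => /andP[c0 _] wc.
  exists c => //; rewrite lt_def c0 andbT; apply/eqP => c00.
  by move: wc aA; rewrite c00 wa => ->; rewrite ltxx.
(* Otherwise [w > 0] up to [2 N + 1], and the positive quotient [mu = - w / w1] is driven down to 0
   there. *)
exfalso.
have pos r : 0 <= r -> r <= 2 * N + 1 -> 0 < w r.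
  move=> r0; rewrite le_eqVlt => /predU1P[->//|rN].
  exact: lt_trans wN (dec _ _ r0 rN).
have lewa r : 0 < r -> w r <= A.
  move=> r0; apply: le_trans (_ : a <= A); last by case/andP: aA.
  by rewrite -wa ltW// dec.
have mu_le r : 0 < r -> r <= 2 * N + 1 -> - (w r / w1 r) <= N / r.
  move=> r0 rN; have w1n := neg r r0.
  have := radial_slope_le (ws' r) r0 (c := w r) _ => H.
  have {}H : w1 r <= - (w r * r / N).
    apply: H => x /andP[x0 xr]; rewrite lerN2.
    apply: (le_trans (ltW (dec _ _ (ltW x0) xr))); apply: Fx.
    rewrite lewa// andbT ltW// pos ?(ltW x0)//.
    exact: le_trans (ltW xr) rN.
  rewrite -mulrN -invrN ler_pdivrMr ?oppr_gt0//.
  rewrite mulrAC ler_pdivlMr//.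
  have N0 : 0 < N by lra.
  move: H; rewrite lerNr ler_pdivrMr// mulrC [_ * N]mulrC; lra.
pose mu r := - (w r / w1 r).
pose mu' r := - (w r * (- (w1 r) ^- 2 * w2 r) + (w1 r)^-1 * w1 r).
have dmu (r : R) : 0 < r -> is_derive r 1 mu (mu' r).
  move=> r0; apply: is_deriveN.
  have w1n : w1 r != 0 by rewrite lt_eqF// neg.
  have := is_deriveM (dw r (ltW r0)) (@is_deriveV R w1 r _ 1 w1n (dw1 r (ltW r0))).
  by [].
have : mu (2 * N + 1) <= 2^-1 - 2^-1 * (2 * N + 1 - 2 * N).
  apply: (@ler_of_derive R (2 * N) (2 * N + 1) mu mu'
    (fun r => 2^-1 - 2^-1 * (r - 2 * N)) (fun=> - 2^-1)).
  - lra.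
  - apply: is_derive_continuous_within => x /andP[x0 _]; apply: dmu; lra.
  - apply: continuous_subspaceT => x; apply: cvgB; first exact: cvg_cst.
    apply: cvgM; first exact: cvg_cst.
    apply: cvgB; [exact: cvg_id|exact: cvg_cst].
  - by move=> x /andP[x0 _]; apply: dmu; lra.
  - move=> x _; have H := is_deriveB (is_derive_id x 1) (is_derive_cst (2 * N) x 1).
    have := is_derive_addl 2^-1 (is_deriveN (is_derive_mull 2^-1 H)).
    by rewrite subr0 mulr1.
  - move=> r /andP[r2 r1].
    have r0 : 0 < r by lra.
    have w1n := neg r r0.
    have Er := E r r0.
    have mule := mu_le r r0 (ltW r1).
    have -> : mu' r = - 1 - w r * F (w r) / (w1 r) ^+ 2 + m%:R / r * mu r.
      rewrite /mu' /mu.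
      have -> : w2 r = - F (w r) - m%:R / r * w1 r by rewrite -Er; ring.
      by field; rewrite (gt_eqF r0) (lt_eqF w1n).
    have T1 : 0 <= w r * F (w r) / (w1 r) ^+ 2.
      rewrite !mulr_ge0 ?invr_ge0 ?sqr_ge0 ?F0// ltW// pos//; lra.
    (* From [mu <= N / r], [m <= N] and [r > 2 N]; hence [mu' <= -1 + 1/4]. *)
    have T2 : m%:R / r * mu r <= 4^-1.
      have mr : 0 <= m%:R / r by rewrite divr_ge0// ltW.
      apply: (le_trans (ler_wpM2l mr mule)).
      rewrite mulrACA -invfM -(mulr1 4^-1) ler_pdivrMr ?mulr_gt0// mulr1.
      have mN : m%:R <= N by rewrite /N ler_nat.
      have m0 : 0 <= m%:R :> R by [].
      nra.
    by lra.
  - rewrite subrr mulr0 subr0.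
    apply: (le_trans (mu_le (2 * N) _ _)); try lra.
    rewrite le_eqVlt; apply/orP; left; apply/eqP; field.
    by rewrite gt_eqF//; lra.
have -> : 2^-1 - 2^-1 * (2 * N + 1 - 2 * N) = 0 :> R by field.
have p1 : 0 < 2 * N + 1 by lra.
have w1n := neg _ p1.
rewrite leNgt /mu oppr_gt0 pmulr_rlt0; last by apply: pos; lra.
by rewrite invr_lt0 w1n.
Qed.

(** * Positive solutions *)

Lemma is_derive_has_deriv_within (R : realType) (D : set R) (f : R -> R)
  (x l : R) : is_derive x 1 f l -> has_deriv_within D f x l.
Proof.
move=> /is_derive_slopeP H; apply: cvg_trans H; apply: cvg_app.
exact: cvg_within.
Qed.

Lemma has_deriv_within_continuous (R : realType) (D : set R) (f df : R -> R) :
  (forall x, D x -> has_deriv_within D f x (df x)) -> {within D, continuous f}.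
Proof.
move=> H; apply/subspace_continuousP => x Dx.
have /cvgrPdist_lt/(_ 1 ltr01) := H x Dx.
rewrite !near_withinE => /nbhs_ballP[dl /= dl0 Hd].
apply/cvgrPdist_lt => e e0.
rewrite near_withinE; apply/nbhs_ballP.
pose M := `|df x| + 1; have M0 : 0 < M by rewrite /M ltr_wpDl.
exists (Num.min dl (e / M)); first by rewrite /= lt_min dl0 divr_gt0.
move=> y; rewrite -?ball_normE /= lt_min => /andP[yd ye] Dy.
have [->|yx] := eqVneq y x; first by rewrite subrr normr0.
have := Hd y; rewrite -?ball_normE => /(_ yd yx Dy) Hs.
have Q : `|(f y - f x) / (y - x)| < M.
  rewrite -[X in `|X|](subrK (df x)) (le_lt_trans (ler_normD _ _))//.
  by rewrite /M addrC ltrD2l distrC.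
have yx0 : y - x != 0 by rewrite subr_eq0.
rewrite distrC -(divfK yx0 (f y - f x)) normrM; rewrite distrC in ye.
apply: (@le_lt_trans _ _ (M * `|y - x|)); first by rewrite ler_wpM2r// ltW.
by rewrite mulrC -ltr_pdivlMr.
Qed.

Lemma has_deriv_within_is_derive (R : realType) (a b x l : R) (f : R -> R) :
  a < x < b -> has_deriv_within `[a, b] f x l -> is_derive x 1 f l.
Proof.
move=> /andP[ax xb] H; apply/is_derive_slopeP.
apply/cvgrPdist_lt => e e0; have /cvgrPdist_lt/(_ _ e0) := H.
rewrite !near_withinE => /nbhs_ballP[dl /= dl0 Hd]; apply/nbhs_ballP.
exists (Num.min dl (Num.min (x - a) (b - x))).
  by rewrite /= !lt_min dl0 !subr_gt0 ax xb.
move=> y; rewrite -?ball_normE /= !lt_min => /and3P[yd ya yb] yx.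
apply: Hd => //.
by move: ya yb; rewrite /= in_itv /= !ltr_norml => /andP[? ?] /andP[? ?]; lra.
Qed.

Lemma trunc_solution_positive (R : realType) m (q A a rho : R)
    (w w1 w2 : R -> R) :
  0 < a <= A -> w 0 = a -> 0 < rho -> w rho = 0 ->
  radial_sol m w w1 w2 (fun r => - trunc_source q A (w r)) ->
  positive_solution m.+1 q (rho ^+ 2) (fun r => w (rho * r)).
Proof.
move=> /[dup] aA /andP[a0 aA'] wa rho0 wrho ws.
have A0 : 0 < A := lt_le_trans a0 aA'.
have F0 x := trunc_source_ge0 q x A0.
have Fx x := @trunc_source_ge R q A x.
have dec := radial_decreasing aA F0 Fx wa ws.
case: ws => w10 dw dw1 cw2 E.
split; first by rewrite exprn_gt0.
exists (fun r => rho * w1 (rho * r)), (fun r => rho * (rho * w2 (rho * r))).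
have rp r : 0 <= r -> 0 <= rho * r by move=> r0; rewrite mulr_ge0 // ltW.
split.
- split.
  + move=> r /=; rewrite in_itv /= => /andP[r0 _].
    by apply: is_derive_has_deriv_within; apply: is_derive_scaled; exact: dw (rp _ r0).
  + move=> r /=; rewrite in_itv /= => /andP[r0 _].
    apply: is_derive_has_deriv_within; apply: is_derive_mull.
    by apply: is_derive_scaled; exact: dw1 (rp _ r0).
  + apply: continuous_in_subspaceT => r; rewrite inE /= in_itv /= => /andP[r0 _].
    have cr : {for r, continuous (fun x => rho * x)}.
      by apply: cvgM; [exact: cvg_cst|exact: cvg_id].
    have := continuous_comp cr (cw2 _ (rp _ r0)) => H.
    apply: cvgM; first exact: cvg_cst.
    by apply: cvgM; [exact: cvg_cst|exact: H].
- move=> r /andP[r0 r1]; rewrite -wrho; apply: dec; first exact: rp.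
  by rewrite -{2}[rho]mulr1 ltr_pM2l.
- move=> r /andP[r0 r1]; have rr : 0 < rho * r by rewrite mulr_gt0.
  have wr : 0 <= w (rho * r) <= A.
    apply/andP; split; last first.
      by apply: le_trans aA'; rewrite -wa ltW// dec.
    rewrite -wrho ltW// dec ?(ltW rr)//.
    by rewrite -{2}[rho]mulr1 ltr_pM2l.
  rewrite -(trunc_source_id q wr) -[trunc_source q A _]opprK -(E _ rr) -natr1.
  by field; rewrite (gt_eqF r0) (gt_eqF rho0).
- by rewrite mulr0 w10 mulr0.
- by rewrite mulr1.
Qed.

(** On [[0, 1]], [u] decreases from [u 0 <= A], so it also solves the truncated problem. So does
    [w (sqrt lambda * r)], with the same initial value; by stability they agree at [r = 1], where
    [u] vanishes. *)
Lemma positive_solution_trunc (R : realType) m (q A lambda : R)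
    (u w w1 w2 : R -> R) :
  1 < q -> positive_solution m.+1 q lambda u -> u 0 <= A -> w 0 = u 0 ->
  radial_sol m w w1 w2 (fun r => - trunc_source q A (w r)) ->
  w (Num.sqrt lambda) = 0.
Proof.
move=> q1 [l0 [u1 [u2 [[du du1 cu2] upos E u10 u01]]]] uA wu ws.
have u00 : 0 < u 0 by apply: upos; rewrite lexx ltr01.
have A0 : 0 < A := lt_le_trans u00 uA.
have rp0 : radial_pair m 1 u u1 (fun r => - (lambda * (u r + u r `^ q))).
  split=> //; [exact: has_deriv_within_continuous du|
    exact: has_deriv_within_continuous du1| |].
  - move=> r /[dup] r01 /andP[r0 r1]; apply: (has_deriv_within_is_derive r01).
    by apply: du; rewrite /= in_itv /= (ltW r0) ltW.
  - move=> r /[dup] r01 /andP[r0 r1]; apply: (has_deriv_within_is_derive r01).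
    have -> : - (lambda * (u r + u r `^ q)) - m%:R / r * u1 r = u2 r.
      by have := E r r01; rewrite -natr1 addrK; lra.
    by apply: du1; rewrite /= in_itv /= (ltW r0) ltW.
have uge r : 0 < r < 1 -> 0 <= u r.
  by move=> /andP[r0 r1]; rewrite ltW// upos// (ltW r0).
have ule r : 0 < r < 1 -> u r <= A.
  move=> /andP[r0 r1]; apply: le_trans uA.
  apply: (radial_antitone rp0) => //; try exact: ltW.
  move=> x x01; rewrite oppr_le0 mulr_ge0 ?(ltW l0)// addr_ge0 ?powR_ge0//.
  exact: uge.
have rp : radial_pair m 1 u u1 (fun r => - (lambda * trunc_source q A (u r))).
  apply: radial_pair_ext rp0 => r r01.
  by rewrite trunc_source_id// uge//= ule.
have s0 : 0 < Num.sqrt lambda by rewrite sqrtr_gt0.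
have rw := radial_pair_scale s0 (radial_sol_pair (Num.sqrt lambda * 1) ws).
have {}rw : radial_pair m 1 (fun r => w (Num.sqrt lambda * r))
    (fun r => Num.sqrt lambda * w1 (Num.sqrt lambda * r))
    (fun r => - (lambda * trunc_source q A (w (Num.sqrt lambda * r)))).
  by apply: radial_pair_ext rw => r _; rewrite sqr_sqrtr ?(ltW l0)// mulrN.
set L := 1 + q * A `^ (q - 1).
have L0 : 0 < L by rewrite /L ltr_wpDr// mulr_ge0 ?powR_ge0//; lra.
have FL : lipschitz_with (lambda * L) (fun x => lambda * trunc_source q A x).
  move=> x y; rewrite -mulrBr normrM gtr0_norm// -mulrA ler_pM2l//.
  exact: trunc_source_lipschitz.
have := radial_stability ler01 (mulr_gt0 l0 L0) FL rp rw (r := 1).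
rewrite ler01 lexx => /(_ isT).
rewrite !mulr0 wu subrr normr0 mulr0 mul0r normr_le0 subr_eq0 u01 mulr1.
by move=> /eqP <-.
Qed.

Lemma trunc_flow (R : realType) m (q A a : R) : 1 < q -> 0 < A ->
  exists w w1 w2 : R -> R, w 0 = a /\
    radial_sol m w w1 w2 (fun r => - trunc_source q A (w r)).
Proof.
move=> q1 A0; apply: radial_picard (trunc_source_lipschitz A0 q1).
by rewrite ltr_wpDr// mulr_ge0 ?powR_ge0//; lra.
Qed.

Lemma positive_solution_exists (R : realType) m (q a : R) : 1 < q -> 0 < a ->
  exists lambda, exists2 u, positive_solution m.+1 q lambda u & u 0 = a.
Proof.
move=> q1 a0; have [w [w1 [w2 [wa ws]]]] := trunc_flow m a q1 a0.
have aa : 0 < a <= a by rewrite a0 lexx.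
have [rho rho0 wrho] := radial_zero aa (fun x => trunc_source_ge0 q x a0)
  (@trunc_source_ge R q a) wa ws.
exists (rho ^+ 2), (fun r => w (rho * r)); last by rewrite mulr0.
exact: trunc_solution_positive aa wa rho0 wrho ws.
Qed.

(** The solutions [u] and [u'] are arbitrary, so taking [a' = a] and every [e] also shows that the
    height determines [lambda]. *)
Lemma solution_parameter_continuous (R : realType) m (q a e : R) : 1 < q ->
  0 < a -> 0 < e -> exists2 dl, 0 < dl & forall a' l l' u u',
    `|a - a'| < dl ->
    positive_solution m.+1 q l u -> u 0 = a ->
    positive_solution m.+1 q l' u' -> u' 0 = a' ->
    `|Num.sqrt l - Num.sqrt l'| <= e.
Proof.
move=> q1 a0 e0.
have [l [u us ua]] := positive_solution_exists m q1 a0.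
(* One truncation level serves all heights [a'] within distance 1 of [a]. *)
pose A := a + 1; have A0 : 0 < A by rewrite /A; lra.
have [w [w1 [w2 [wa ws]]]] := trunc_flow m a q1 A0.
have F0 x := trunc_source_ge0 q x A0.
have Fx x := @trunc_source_ge R q A x.
set L := 1 + q * A `^ (q - 1).
have L0 : 0 < L by rewrite /L ltr_wpDr// mulr_ge0 ?powR_ge0//; lra.
have FL : lipschitz_with L (trunc_source q A) := trunc_source_lipschitz A0 q1.
have aA : 0 < a <= A by rewrite a0 /A; lra.
have zero l1 u3 : positive_solution m.+1 q l1 u3 -> u3 0 = a ->
    w (Num.sqrt l1) = 0.
  move=> us3 ua3; apply: (positive_solution_trunc q1 us3 _ _ ws).
    by rewrite ua3; case/andP: aA.
  by rewrite wa ua3.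
have dec := radial_decreasing aA F0 Fx wa ws.
set rho := Num.sqrt l.
have wrho : w rho = 0 by apply: zero us ua.
have rho0 : 0 < rho by rewrite sqrtr_gt0; case: us.
have uniq r : 0 <= r -> w r = 0 -> r = rho.
  move=> r0 wr; apply/eqP; case: (ltgtP r rho) => // h; exfalso.
    by have := dec _ _ r0 h; rewrite wr wrho ltxx.
  by have := dec _ _ (ltW rho0) h; rewrite wr wrho ltxx.
(* [s] and [B] bracket the zero with [w s > 0 > w B]; the maximum keeps [s] in the domain when
   [e > rho]. *)
pose B := rho + e; pose s := Num.max 0 (rho - e).
have B0 : 0 <= B by rewrite /B; lra.
have wB : w B < 0 by rewrite -wrho; apply: dec; rewrite /B; lra.
have s0 : 0 <= s by rewrite /s le_max lexx.
have srho : s < rho by rewrite /s gt_max rho0 /=; lra.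
have wS : 0 < w s by rewrite -wrho; exact: dec.
pose M := 2 * expR ((1 + 2 * L) * B).
have M0 : 0 < M by rewrite /M mulr_gt0 ?expR_gt0.
(* The first two bounds give [0 < a' <= A]; the last two make the stability error smaller than [w s]
   and [- w B], so [v] has the signs of [w] there. *)
exists (Num.min (Num.min a 1) (Num.min (w s / M) (- w B / M))).
  by rewrite !lt_min a0 ltr01 !divr_gt0 ?oppr_gt0.
move=> a' l1 l' u3 u'; rewrite !lt_min => /andP[/andP[aa1 aa2] /andP[aas aaB]].
move=> us3 ua3 us' ua'.
have -> : Num.sqrt l1 = rho by apply: uniq; [exact: sqrtr_ge0|exact: zero us3 ua3].
have a'A : 0 < a' <= A.
  by move: aa1 aa2; rewrite !ltr_norml /A => /andP[? ?] /andP[? ?]; lra.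
have [v [v1 [v2 [va vs]]]] := trunc_flow m a' q1 A0.
have decv := radial_decreasing a'A F0 Fx va vs.
have vz : v (Num.sqrt l') = 0.
  apply: (positive_solution_trunc q1 us' _ _ vs).
    by rewrite ua'; case/andP: a'A.
  by rewrite va ua'.
have close r : 0 <= r <= B -> `|w r - v r| <= `|a - a'| * M.
  move=> rB; have := radial_stability B0 L0 FL (radial_sol_pair B ws)
    (radial_sol_pair B vs) rB.
  rewrite wa va => H; apply: (le_trans H); rewrite /M mulrCA [leRHS]mulrA.
  rewrite ler_wpM2l ?mulr_ge0// ler_expR ler_wpM2l//.
    by rewrite addr_ge0// mulr_ge0// ltW.
  by case/andP: rB.
have vB : v B < 0.
  have := close B; rewrite B0 lexx => /(_ isT) H.
  have {}H : `|w B - v B| < - w B.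
    by apply: (le_lt_trans H); rewrite -ltr_pdivlMr.
  by move: H; rewrite ltr_norml => /andP[]; lra.
have vS : 0 < v s.
  have := close s; rewrite s0 /= => /(_ _) H.
  have {}H : `|w s - v s| < w s.
    apply: (le_lt_trans (H _)); last by rewrite -ltr_pdivlMr.
    by rewrite /B; lra.
  by move: H; rewrite ltr_norml => /andP[]; lra.
have H1 : Num.sqrt l' < B.
  rewrite ltNge; apply/negP; rewrite le_eqVlt => /predU1P[h|h].
    by move: vB; rewrite h vz ltxx.
  by have := decv _ _ B0 h; rewrite vz; lra.
have H2 : s < Num.sqrt l'.
  rewrite ltNge; apply/negP; rewrite le_eqVlt => /predU1P[h|h].
    by move: vS; rewrite -h vz ltxx.
  by have := decv _ _ (sqrtr_ge0 l') h; rewrite vz; lra.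
have H3 : rho - e <= s by rewrite /s le_max lexx orbT.
by rewrite ler_norml; apply/andP; split; move: H1 H2 H3; rewrite /B; lra.
Qed.

(** * The solution set as a single curve *)

Theorem theorem2p1 (R : realType) (n : nat) (q : R) (hn : (1 <= n)%N)
    (hq : 1 < q) :
  exists C : set (R * R),
    [/\ solution_curve n q C,
        forall D : set (R * R), solution_curve n q D -> D = C &
        forall (lambda : R) (u : R -> R),
          positive_solution n q lambda u -> C (lambda, u 0)].
Proof.
case: n hn => [//|m] _.
have /choice[lam Hlam] : forall a : R, exists l, 0 < a ->
    exists2 u, positive_solution m.+1 q l u & u 0 = a.
  move=> a; have [a0|_] := ltP 0 a; last by exists 0.
  by have [l Hl] := positive_solution_exists m hq a0; exists l.
pose S := solution_set m.+1 q.
pose I : set R := `]0, +oo[%classic.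
(* The first entry equals [lam a] for [a > 0]; this form matches the continuity result, which
   concerns [sqrt lambda]. *)
pose g (a : R) : R * R := (Num.sqrt (lam a) ^+ 2, a).
have uniq l u : positive_solution m.+1 q l u -> 0 < u 0 /\ l = lam (u 0).
  move=> us; have u0 : 0 < u 0.
    by case: us => _ [u1 [u2 [_ H _ _ _]]]; apply: H; rewrite lexx ltr01.
  split=> //; have [v vs va] := Hlam _ u0.
  have E : Num.sqrt l = Num.sqrt (lam (u 0)).
    apply/eqP; rewrite -subr_eq0 -normr_le0; apply/ler_addgt0Pr => e e0.
    have [dl dl0 H] := solution_parameter_continuous m hq u0 e0.
    by rewrite add0r; apply: (H (u 0) _ _ u v) => //; rewrite subrr normr0.
  rewrite -[l]sqr_sqrtr; last by case: us => /ltW.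
  by rewrite E sqr_sqrtr//; case: vs => /ltW.
have SE : S = g @` I.
  apply/seteqP; split=> [[l a] [u us /= ->]|_ [a /= aI <-]].
    have [u0 lE] := uniq _ _ us.
    exists (u 0); first by rewrite /I /= in_itv /= u0.
    rewrite /g -lE sqr_sqrtr//; by case: us => /ltW.
  have a0 : 0 < a by move: aI; rewrite /I /= in_itv /= andbT.
  have [u us ua] := Hlam _ a0.
  exists u; last by rewrite ua.
  by rewrite /g /= sqr_sqrtr//; case: us => /ltW.
have cg : {within I, continuous g}.
  apply: continuous_in_subspaceT => a; rewrite inE /I /= in_itv /= andbT => a0.
  have cs : {for a, continuous (fun x => Num.sqrt (lam x))}.
    apply/cvgrPdist_le => e e0.
    have [dl dl0 H] := solution_parameter_continuous m hq a0 e0.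
    apply/nbhs_ballP; exists (Num.min dl a); first by rewrite /= lt_min dl0.
    move=> y; rewrite -?ball_normE /= lt_min => /andP[yd ya].
    have y0 : 0 < y by move: ya; rewrite ltr_norml => /andP[_]; lra.
    have [u us ua] := Hlam _ a0; have [v vs va] := Hlam _ y0.
    exact: (H y _ _ u v).
  have c2 : Num.sqrt (lam x) ^+ 2 @[x --> a] --> Num.sqrt (lam a) ^+ 2.
    exact: (cvgM cs cs).
  rewrite /prop_for /continuous_at.
  exact: (cvg_pair c2 (@cvg_id _ (nbhs a))).
have iI : is_interval I by exact: interval_is_interval.
have cS : connected S.
  rewrite SE; apply: connected_continuous_connected cg.
  exact/connected_intervalP.
have S0 : S !=set0.
  have [l [u us _]] := positive_solution_exists m hq (@ltr01 R).
  by exists (l, u 0), u.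
exists S; split.
- split=> //; last by exists I, g.
  by move=> D DS _ SD; apply/seteqP.
(* [S] is a connected subset of itself containing [D], so maximality of [D] forces equality. *)
- by move=> D [_ DS cD maxD _]; apply/esym/maxD.
- by move=> l u us; exists u.
Qed.
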